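(* For $u,v,n \in \mathbb{N}$, let $C'_4(u,v,n)$ denote the number of partitions of $n$ into $u$ distinct parts congruent to $3$ modulo $4$ and $v$ distinct parts congruent to $1$ modulo $4$ (all parts distinct). Let $D'_4(u,v,n)$ denote the number of partitions $\lambda_1 + \cdots + \lambda_s$ of $n$ (positive integer parts, $\lambda_1\ge\cdots\ge\lambda_s$) such that $u$ equals the number of parts congruent to $0$ or $3$ modulo $4$ plus twice the number of parts congruent to $2$ modulo $8$, and $v$ equals the number of parts congruent to $0$ or $1$ modulo $4$ plus twice the number of parts congruent to $6$ modulo $8$, satisfying the following conditions: (1) for all $i$, $\lambda_i \neq 2$; (2) for all $1\le i<s$: $\lambda_i - \lambda_{i+1} \in \{5,6,8,9\}$ or $\geq 11$ if $\lambda_{i} \equiv 0 \pmod 8$; $\lambda_i - \lambda_{i+1} = 2$ or $\geq 5$ if $\lambda_{i} \equiv 1 \pmod 8$; $\lambda_i - \lambda_{i+1} = 11$ or $\geq 13$ if $\lambda_{i} \equiv 2 \pmod 8$; $\lambda_i - \lambda_{i+1} \geq 7$ if $\lambda_{i} \equiv 3 \pmod 8$; $\lambda_i - \lambda_{i+1} = 5$ or $\geq 7$ if $\lambda_{i} \equiv 4 \pmod 8$; $\lambda_i - \lambda_{i+1} \in \{2,3,5,6\}$ or $\geq 8$ if $\lambda_{i} \equiv 5 \pmod 8$; $\lambda_i - \lambda_{i+1} \in \{3,4,6,7\}$ or $\geq 9$ if $\lambda_{i} \equiv 6 \pmod 8$; $\lambda_i - \lambda_{i+1} = 8$ or $\geq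 10$ if $\lambda_{i} \equiv 7 \pmod 8$. Then $C'_4(u,v,n)=D'_4(u,v,n)$ for all $u,v,n\in\mathbb{N}$. *)

(* Defs.v *)
From mathcomp Require Import all_boot.
Set Implicit Arguments. Unset Strict Implicit. Unset Printing Implicit Defensive.

(* A partition of n with distinct parts is identified with its set of parts,
   a subset of {0..n} not containing 0, whose elements sum to n. *)
Definition distinct_partition (n : nat) (A : {set 'I_n.+1}) : bool :=
  (ord0 \notin A) && (\sum_(i in A) (i : nat) == n).

Definition C4' (u v n : nat) : nat :=
  #|[set A : {set 'I_n.+1} | distinct_partition A
      && [forall i in A, ((i : nat) %% 4 == 3) || ((i : nat) %% 4 == 1)]
      && (#|[set i in A | (i : nat) %% 4 == 3]| == u)
      && (#|[set i in A | (i : nat) %% 4 == 1]| == v)]|.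

(* A general partition of n is identified with its multiplicity function
   m : {0..n} -> {0..n} (m i = number of parts equal to i), with m 0 = 0 and
   sum_i i * m i = n. *)
Definition mult_partition (n : nat) (m : {ffun 'I_n.+1 -> 'I_n.+1}) : bool :=
  (m ord0 == 0 :> nat) && (\sum_(i : 'I_n.+1) (i : nat) * m i == n).

Definition parts_of (n : nat) (m : {ffun 'I_n.+1 -> 'I_n.+1}) : seq nat :=
  flatten [seq nseq (m i) (i : nat) | i <- rev (enum 'I_n.+1)].

Definition diff_ok (l d : nat) : bool :=
  match l %% 8 with
  | 0 => (d \in [:: 5; 6; 8; 9]) || (11 <= d)
  | 1 => (d == 2) || (5 <= d)
  | 2 => (d == 11) || (13 <= d)
  | 3 => 7 <= d
  | 4 => (d == 5) || (7 <= d)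
  | 5 => (d \in [:: 2; 3; 5; 6]) || (8 <= d)
  | 6 => (d \in [:: 3; 4; 6; 7]) || (9 <= d)
  | _ => (d == 8) || (10 <= d)
  end.

Fixpoint diff_conds (s : seq nat) : bool :=
  match s with
  | x :: ((y :: _) as t) => diff_ok x (x - y) && diff_conds t
  | _ => true
  end.

Definition D4_cond (s : seq nat) : bool := (2 \notin s) && diff_conds s.

Definition D4_u (s : seq nat) : nat :=
  count (fun x => (x %% 4 == 0) || (x %% 4 == 3)) s + 2 * count (fun x => x %% 8 == 2) s.
Definition D4_v (s : seq nat) : nat :=
  count (fun x => (x %% 4 == 0) || (x %% 4 == 1)) s + 2 * count (fun x => x %% 8 == 6) s.

Definition D4' (u v n : nat) : nat :=
  #|[set m : {ffun 'I_n.+1 -> 'I_n.+1} | mult_partition m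
      && D4_cond (parts_of m)
      && (D4_u (parts_of m) == u) && (D4_v (parts_of m) == v)]|.

(* Main.v *)
Require Import Defs.
From mathcomp Require Import all_boot.
From mathcomp Require Import all_algebra.
From mathcomp Require Import ring zify.
Set Implicit Arguments. Unset Strict Implicit. Unset Printing Implicit Defensive.
Import GRing.Theory Num.Theory.

(** The set of parts that may follow a given part always belongs to one chain of
    nested sets, of four kinds modulo 8, so the generating functions of the
    admissible lists whose largest part lies in a given set of the chain obey a
    linear recurrence. Mark parts 3 mod 4 by a, parts 1 mod 4 by b and size by q.
    Put t = q^4, s = b q + a q^3 and p = a b q^4. Two of these functions suffice:
    U_k (parts at most 8k+4) and F_k (parts at most 8k-3, or equal to 8k-1).
    Writing ' for the substitution (a, b) -> (a t, b t), they satisfy the finite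
    identity U_k = (1 + b q)(1 + a q^3) F'_k, proved by induction jointly with
      F_(k+1) = (1 + (s + p)(1 + t)) F'_k
                - (1 - t^(2k)) ((s + p) t U'_(k-1) + p t^(2k+1) F'_(k-1)).
    Since F_(k+1) - U_k is divisible by q^(8k), iterating the identity gives, to
    any order in q, the product of all (1 + b q^(4i+1)) (1 + a q^(4i+3)). *)

(** * Admissible partitions as strictly decreasing lists *)

Fixpoint declists (N : nat) : seq (seq nat) :=
  if N is n.+1 then declists n ++ [seq n :: s | s <- declists n] else [:: [::]].

Definition valid (s : seq nat) : bool := (0%N \notin s) && D4_cond s.

Lemma mem_declists N s : (s \in declists N) = path gtn N s.
Proof.
elim: N s => [|n IH] s /=; first by case: s => [|x s].
rewrite mem_cat IH; case: s => [|x s] //=.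
have -> : (x :: s \in [seq n :: s0 | s0 <- declists n]) = (x == n) && (s \in declists n).
  apply/mapP/andP => [[s' s'in [-> ->]]|[/eqP -> sin]]; first by rewrite eqxx.
  by exists s.
rewrite IH ltnS [x <= n]leq_eqVlt orbC.
by case: eqP => [->|]; rewrite //= ltnn orbF.
Qed.

Lemma uniq_declists N : uniq (declists N).
Proof.
elim: N => [|n IH] //=; rewrite cat_uniq IH map_inj_uniq ?IH /= ?andbT; last by move=> s t [].
apply/hasPn=> _ /mapP[s _ ->]; rewrite mem_declists.
by rewrite /= ltnn.
Qed.

(** No residue class allows the difference 0, which is also what truncated subtraction returns when
    the next part is larger. *)
Lemma diff_conds_sorted s : diff_conds s -> sorted gtn s.
Proof.
elim: s => [|x [|y s] IH] //= /andP[xy /IH]; rewrite /= => ->; rewrite andbT.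
have : 0 < x - y; last by rewrite subn_gt0.
case: (x - y) xy => //; rewrite /diff_ok.
by case: (x %% 8) => [|[|[|[|[|[|[|[]]]]]]]].
Qed.

Section Parts.
Variables (n : nat) (m : {ffun 'I_n.+1 -> 'I_n.+1}).

Lemma count_parts p : count p (parts_of m) = \sum_(i < n.+1) p (i : nat) * m i.
Proof.
rewrite /parts_of count_flatten -map_comp map_rev sumn_rev sumnE big_map big_enum /=.
by apply: eq_bigr => i _; rewrite count_nseq.
Qed.

Lemma count_mem_parts (i : 'I_n.+1) : count_mem (i : nat) (parts_of m) = m i.
Proof.
rewrite count_parts (bigD1 i) //= eqxx mul1n big1 ?addn0 // => j /negPf.
by rewrite -val_eqE /= => ->.
Qed.

Lemma sumn_parts : sumn (parts_of m) = \sum_(i < n.+1) i * m i.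
Proof.
rewrite /parts_of sumn_flatten -map_comp map_rev sumn_rev sumnE big_map big_enum /=.
by apply: eq_bigr => i _; rewrite sumn_nseq.
Qed.

Lemma parts_lt : all (fun x => x < n.+1) (parts_of m).
Proof.
apply/allP=> x /flattenP[_ /mapP[i _ ->]]; rewrite mem_nseq => /andP[_ /eqP ->].
exact: ltn_ord.
Qed.

Lemma parts_sorted : sorted geq (parts_of m).
Proof.
rewrite /parts_of.
have : sorted gtn (map val (rev (enum 'I_n.+1))).
  by rewrite map_rev val_enum_ord rev_sorted iota_ltn_sorted.
rewrite sorted_map; elim: (rev _) => [|i l IH] //= il.
rewrite sorted_pairwise; last exact: rev_trans leq_trans.
rewrite pairwise_cat -!sorted_pairwise; try exact: rev_trans leq_trans.
rewrite IH ?(path_sorted il) // andbT.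
apply/andP; split; last by elim: (m i : nat) => //= -[|k] //= ->; rewrite leqnn.
apply/allrelP=> x y; rewrite mem_nseq => /andP[_ /eqP ->] /flattenP[_ /mapP[j jl ->]].
rewrite mem_nseq => /andP[_ /eqP ->] /=.
move: il; rewrite path_sortedE; last by move=> ? ? ? /= ? /ltn_trans; apply.
by case/andP=> /allP/(_ _ jl) /ltnW.
Qed.
End Parts.

Lemma parts_inj n : injective (@parts_of n).
Proof.
move=> m m' E; apply/ffunP=> i; apply/val_inj.
by rewrite /= -!count_mem_parts E.
Qed.

(** Every multiplicity is at most [size s], hence at most n because the parts are positive, so
    [inord] loses nothing. Both sides are then sorted lists with equal counts. *)
Lemma parts_of_count n s : 0 \notin s -> sumn s = n -> sorted gtn s ->
  parts_of [ffun i : 'I_n.+1 => inord (count_mem (i : nat) s) : 'I_n.+1] = s.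
Proof.
move=> s0 sn ss; set m := finfun _.
have geq_tr : transitive geq by exact: rev_trans leq_trans.
have szs : size s <= n.
  elim: s n s0 sn {ss m} => [|x s IH] n //=; rewrite inE negb_or => /andP[x0 s0] <-.
  by rewrite -add1n leq_add ?IH // lt0n eq_sym.
have sle x : x \in s -> x < n.+1.
  rewrite ltnS -sn; elim: s {s0 sn ss szs m} => [|y s IH] //=; rewrite inE.
  by case/predU1P => [->|/IH]; lia.
apply: (sorted_eq geq_tr); last 1 first.
- apply/allP=> x _; apply/eqP; have [xn|nx] := ltnP x n.+1.
    rewrite (count_mem_parts m (Ordinal xn)) /m ffunE inordK //=.
    by rewrite ltnS; apply: leq_trans (count_size _ _) szs.
  rewrite (count_memPn _) ?(count_memPn _) //; apply/negP.
    by move/sle; lia.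
  by move/(allP (parts_lt m)); lia.
- by move=> x y; rewrite -eqn_leq => /eqP.
- exact: parts_sorted.
- by apply: sub_sorted ss => x y /ltnW.
Qed.

(** The bound N is left free: the final argument needs one of the form [k * 8 + 5] with k large. *)
Lemma D4'_declists u v n N : n < N -> D4' u v n =
  count (fun s => [&& valid s, D4_u s == u, D4_v s == v & sumn s == n]) (declists N).
Proof.
move=> nN; rewrite /D4' cardE -(size_map (@parts_of n)) -size_filter.
apply/perm_size/uniq_perm; rewrite ?filter_uniq ?uniq_declists //.
  by rewrite map_inj_uniq ?enum_uniq //; exact: parts_inj.
move=> s; rewrite mem_filter mem_declists; apply/mapP/idP => [[m]|].
  rewrite mem_enum inE => /andP[/andP[/andP[/andP[m0 mn] mD] mu] mv] ->.
  have sn : sumn (parts_of m) = n by rewrite sumn_parts; apply/eqP.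
  rewrite /valid mD mu mv sn eqxx -has_pred1 has_count.
  rewrite (count_mem_parts m ord0) (eqP m0) /=.
  rewrite path_sortedE; last exact: rev_trans ltn_trans.
  rewrite diff_conds_sorted ?andbT; last by case/andP: mD.
  by apply: sub_all (parts_lt m) => x /leq_trans; apply.
case/andP=> /and4P[/andP[s0 sD] su sv /eqP sn] /path_sorted ss.
have E := parts_of_count s0 sn ss; set m := finfun _ in E.
exists m; rewrite ?E // mem_enum inE E sD su sv !andbT /mult_partition.
by rewrite -sumn_parts E sn eqxx -[X in X == _]count_mem_parts E (count_memPn s0).
Qed.

Definition ucol (x : nat) : nat :=
  (((x %% 4 == 0) || (x %% 4 == 3)) + 2 * (x %% 8 == 2)).
Definition vcol (x : nat) : nat :=
  (((x %% 4 == 0) || (x %% 4 == 1)) + 2 * (x %% 8 == 6)).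

Lemma ucolMD k c : ucol (k * 8 + c) = ucol c.
Proof. by rewrite /ucol modnMDl -[8]/(2 * 4) mulnA modnMDl. Qed.

Lemma vcolMD k c : vcol (k * 8 + c) = vcol c.
Proof. by rewrite /vcol modnMDl -[8]/(2 * 4) mulnA modnMDl. Qed.

Lemma diff_okMD k c d : diff_ok (k * 8 + c) d = diff_ok c d.
Proof. by rewrite /diff_ok modnMDl. Qed.

(** * The coupled recurrence and its behaviour under the shift of variables *)

Local Open Scope ring_scope.

Definition coupled_rec (R : comNzRingType) (s p t : R) (U F : nat -> R) : Prop :=
  [/\ F 0 = 1, U 0 = 1 + s + p, F 1 = 1 + s + p + (s + p) * t,
      forall k, U k.+1 = (1 + s + p * t ^+ (k * 2).+2) * F k.+1
        - (1 - t ^+ (k * 2).+2) * (s * U k + p * t ^+ (k * 2).+1 * F k)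
    & forall k, F k.+2 = U k.+1 + (s + p) * t ^+ (k * 2).+3 * F k.+1
        - p * t ^+ (k * 2).+3 * (1 - t ^+ (k * 2).+2) * U k].

(** Replacing (a, b) by (a t, b t) multiplies s by t and p by t^2, hence the parameters of the
    second system. Each new case uses the two before it, so [P k] and [P k.+1] are carried
    together. *)
Lemma coupled_rec_shift (R : comNzRingType) (s p t : R) (U F U' F' : nat -> R) k :
  coupled_rec s p t U F -> coupled_rec (s * t) (p * t ^+ 2) t U' F' ->
  U k = (1 + s + p) * F' k.
Proof.
move=> [F0 U0 F1 UE FE] [F0' U0' F1' UE' FE'].
(* At k = 0 the factor 1 - t^(2k) vanishes, so the correction is 0 and no index -1 arises. *)
pose C k := if k is j.+1 then
  (1 - t ^+ (j * 2).+2) * ((s + p) * t * U' j + p * t ^+ (j * 2).+3 * F' j) else 0.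
pose P k := U k = (1 + s + p) * F' k
  /\ F k.+1 = (1 + (s + p) * (1 + t)) * F' k - C k.
suff H : P k /\ P k.+1 by case: H => -[].
have step1 j : P j -> P j.+1 -> P j.+2.
  (* The case j = 0 is separate because it meets [C 0] and the initial values of the shifted
     system. *)
  case: j => [|j] [D0 C0] [D1 C1].
    have D2 : U 2 = (1 + s + p) * F' 2.
      rewrite UE C1 C0 D1 /C FE' UE' F1' U0' F0'.
      by rewrite ?mul1n ?mul0n !exprS expr0; ring.
    by split=> //; rewrite FE D2 C1 D1 /C FE' UE' F1' U0' F0' /= ?mul1n ?mul0n !exprS expr0; ring.
  have D2 : U j.+3 = (1 + s + p) * F' j.+3.
    rewrite UE C1 C0 D1 /C !(FE', UE') /=.
    by rewrite mulSn !add2n !exprS expr0; ring.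
  split=> //; rewrite FE D2 C1 D1 /C !(FE', UE') /=.
  by rewrite !mulSn !add2n !exprS expr0; ring.
elim: k => [|k [IH0 IH1]]; last by split=> //; exact: step1.
have D1 : U 1 = (1 + s + p) * F' 1.
  by rewrite UE F1 F1' U0 F0 ?mul1n ?mul0n !exprS expr0; ring.
split; split=> //; rewrite ?FE ?D1 ?F1 /C ?U0 ?F0 ?F1' ?U0' ?F0' ?exprS ?expr0; ring.
Qed.

(** * Generating functions of lists with prescribed largest parts *)

Section Weights.
Variables (R : comNzRingType) (a b q : R).

(* An even part carries the marks of two odd parts of which it is the sum. *)
Definition wt (x : nat) : R := a ^+ ucol x * b ^+ vcol x * q ^+ x.

Definition lwt (s : seq nat) : R := \prod_(x <- s) wt x.

Lemma wtMD k c : wt (k * 8 + c)%N = wt c * q ^+ (k * 8)%N.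
Proof. by rewrite /wt ucolMD vcolMD addnC exprD mulrA. Qed.

Lemma lwtE s : lwt s = a ^+ D4_u s * b ^+ D4_v s * q ^+ sumn s.
Proof.
elim: s => [|x s IH]; first by rewrite /lwt big_nil !mul1r.
rewrite /lwt big_cons -/(lwt s) IH /wt.
have -> : D4_u (x :: s) = (ucol x + D4_u s)%N by rewrite /D4_u /ucol /=; lia.
have -> : D4_v (x :: s) = (vcol x + D4_v s)%N by rewrite /D4_v /vcol /=; lia.
by rewrite /= !exprD; ring.
Qed.

Definition hdgf (y : nat) : R :=
  \sum_(s <- declists y | valid (y :: s)) lwt (y :: s).

Definition hd_in (P : pred nat) (s : seq nat) : bool :=
  if s is y :: _ then P y else true.

Definition seg (N : nat) (P : pred nat) : R :=
  1 + \sum_(0 <= y < N | P y) hdgf y.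

Lemma gf_valid N (P : pred nat) :
  \sum_(s <- declists N | valid s && hd_in P s) lwt s = seg N P.
Proof.
rewrite /seg; elim: N => [|N IH].
  by rewrite [in RHS]big_geq // big_cons big_nil /= /lwt big_nil.
rewrite big_cat IH big_map [in RHS]big_mkcond big_nat_recr //= -big_mkcond /= -addrA.
congr (_ + (_ + _)); rewrite /hdgf; case: ifP => PN.
  by apply: eq_bigl => s; rewrite andbT.
by rewrite big_pred0 // => s; rewrite andbF.
Qed.

Lemma hdgf0 : hdgf 0%N = 0.
Proof. by rewrite /hdgf big1 // => s; rewrite /valid inE. Qed.

Lemma hdgf2 : hdgf 2%N = 0.
Proof. by rewrite /hdgf big1 // => s; rewrite /valid /D4_cond inE /= andbF. Qed.

(** The condition linking y to its tail involves only the head of the tail. *)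
Lemma hdgfE y : y != 0%N -> y != 2%N ->
  hdgf y = wt y * seg y (fun z => diff_ok y (y - z)).
Proof.
move=> y0 y2; rewrite -gf_valid big_distrr /=; apply: eq_big => [s|s _]; last first.
  by rewrite /lwt big_cons.
rewrite /valid /D4_cond !inE ![_ == y]eq_sym (negPf y0) (negPf y2) /=.
by case: s => [|z s] /=; rewrite ?andbT // -!andbA; congr (_ && (_ && _)); rewrite andbC.
Qed.

Lemma seg_widen M N P : (N <= M)%N ->
  seg N P = 1 + \sum_(0 <= z < M | [&& z != 0, z != 2 & (z < N) && P z]%N) hdgf z.
Proof.
move=> NM; rewrite /seg; congr (1 + _).
rewrite (big_nat_widen _ _ _ _ _ NM) big_mkcond [RHS]big_mkcond; apply: eq_bigr => z _.
case: (eqVneq z 0%N) => [->|_] /=; first by rewrite hdgf0 if_same.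
case: (eqVneq z 2%N) => [->|_] /=; first by rewrite hdgf2 if_same.
by rewrite andbC.
Qed.

(** [hdgf] vanishes at 0, which is no part, and at 2, which is forbidden, so sets that agree
    elsewhere are interchangeable. *)
Lemma eq_seg N N' (P P' : pred nat) :
  (forall z, z != 0 -> z != 2 -> (z < N) && P z = (z < N') && P' z)%N ->
  seg N P = seg N' P'.
Proof.
move=> E; rewrite (seg_widen P (leq_maxl N N')) (seg_widen P' (leq_maxr N N')).
congr (1 + _); apply: eq_bigl => z.
by case: (eqVneq z 0%N) => //= z0; case: (eqVneq z 2%N) => //= z2; rewrite E.
Qed.

Lemma seg_add x N N' (P P' : pred nat) : x != 0%N -> x != 2%N ->
  ~~ ((x < N) && P x)%N ->
  (forall z, z != 0 -> z != 2 -> (z < N') && P' z = (z < N) && P z || (z == x))%N ->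
  seg N' P' = seg N P + hdgf x.
Proof.
move=> x0 x2 nP E; pose M := maxn x.+1 (maxn N N').
have NM : (N <= M)%N by rewrite /M; lia.
have NM' : (N' <= M)%N by rewrite /M; lia.
have xM : (x < M)%N by rewrite /M; lia.
rewrite (seg_widen P NM) (seg_widen P' NM') -addrA; congr (1 + _).
rewrite !big_mkord (bigD1 (Ordinal xM)) /=; last by rewrite x0 x2 E // eqxx orbT.
rewrite addrC; congr (_ + _); apply: eq_bigl => z.
rewrite -val_eqE /=; case: (eqVneq (z : nat) 0%N) => //= z0.
case: (eqVneq (z : nat) 2%N) => //= z2; rewrite E //.
by case: (eqVneq (z : nat) x) => [->|]; rewrite ?orbT ?orbF ?(negPf nP) ?andbT ?andbF.
Qed.

Lemma seg_adds xs N N' (P P' : pred nat) : uniq xs ->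
  all (fun x => [&& x != 0, x != 2 & ~~ ((x < N) && P x)])%N xs ->
  (forall z, z != 0 -> z != 2 ->
    (z < N') && P' z = (z < N) && P z || (z \in xs))%N ->
  seg N' P' = seg N P + \sum_(x <- xs) hdgf x.
Proof.
elim: xs N P => [|x xs IH] N P /=.
  by move=> _ _ E; rewrite big_nil addr0; apply: eq_seg => z z0 z2; rewrite E // orbF.
case/andP=> xxs uxs /andP[/and3P[x0 x2 nP] axs] E.
(* The range test is built into [P1], so raising the bound to [M] admits no point but x. *)
pose M := maxn N x.+1; pose P1 z := (z < N)%N && P z || (z == x).
have PM z : (z < M)%N && P1 z = P1 z.
  by rewrite /P1 /M; case: eqVneq => [->|]; rewrite ?orbT ?orbF; [lia|case: (P z); lia].
rewrite big_cons addrA (IH M P1) //.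
- by congr (_ + _); apply: seg_add => // z _ _; rewrite PM.
- apply/allP=> z zxs; have /and3P[z0 z2 nPz] := allP axs z zxs.
  rewrite PM z0 z2 /P1 (negPf nPz) /=.
  by apply: contraNneq xxs => <-.
- by move=> z z0 z2; rewrite PM E // inE orbA.
Qed.

(* The nested sets of the chain, in which 0 and 2 do not matter. Conditions such as
   z <= 8k-3 are written z + 3 <= 8k because natural subtraction truncates. *)
Definition Useg k := seg (k * 8 + 5)%N predT.
Definition Fseg k := seg (k * 8)%N (fun z => (z + 3 <= k * 8) || (z.+1 == k * 8))%N.
Definition Tseg k := seg (k * 8 + 4)%N
  (fun z => [|| z + 3 <= k * 8, z.+1 == k * 8, z == k * 8 | k * 8 + 2 <= z])%N.
Definition Vseg k := seg (k * 8 + 8)%N (fun z => (z < k * 8 + 5) || (z == k * 8 + 7))%N.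

Ltac segs := move=> z z0 z2; rewrite /= ?diff_okMD /diff_ok /= ?inE; lia.


(** Used with (N, P) a set of the chain: each part added to a set then contributes a monomial times
    one of the four functions. *)
Lemma hdgfMD (k c : nat) N P : (k * 8 + c != 0)%N -> (k * 8 + c != 2)%N ->
  (forall z, z != 0 -> z != 2 ->
    (z < k * 8 + c) && diff_ok c (k * 8 + c - z) = (z < N) && P z)%N ->
  hdgf (k * 8 + c)%N = wt c * q ^+ (k * 8)%N * seg N P.
Proof.
move=> n0 n2 E; rewrite hdgfE // wtMD; congr (_ * _); apply: eq_seg => z z0 z2.
by rewrite diff_okMD E.
Qed.

(** The chain climbs from U_k to V_k by 8k+7, to F_(k+1) by 8k+5, to T_(k+1) by 8k+8, 8k+10, 8k+11,
    and to U_(k+1) by 8k+6, 8k+9, 8k+12. This lemma and the next three record these steps. *)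
Lemma FsegS k : Fseg k.+1 = Vseg k + wt 5 * q ^+ (k * 8)%N * Tseg k.
Proof.
rewrite -hdgfMD; [|lia|lia|segs].
by apply: seg_add; [lia|lia|lia|segs].
Qed.

Lemma VsegE k : Vseg k = Useg k + wt 7 * q ^+ (k * 8)%N * Fseg k.
Proof.
rewrite -hdgfMD; [|lia|lia|segs].
by apply: seg_add; [lia|lia|lia|segs].
Qed.

Lemma UsegS k : Useg k.+1 = Tseg k.+1 + (wt 6 * Tseg k + wt 9 * Vseg k
  + wt 12 * Fseg k.+1) * q ^+ (k * 8)%N.
Proof.
have h6 : hdgf (k * 8 + 6)%N = wt 6 * q ^+ (k * 8)%N * Tseg k.
  by apply: hdgfMD; [lia|lia|segs].
have h9 : hdgf (k * 8 + 9)%N = wt 9 * q ^+ (k * 8)%N * Vseg k.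
  by apply: hdgfMD; [lia|lia|segs].
have h12 : hdgf (k * 8 + 12)%N = wt 12 * q ^+ (k * 8)%N * Fseg k.+1.
  by apply: hdgfMD; [lia|lia|segs].
have -> : Useg k.+1 = Tseg k.+1
    + \sum_(x <- [:: k * 8 + 6; k * 8 + 9; k * 8 + 12]%N) hdgf x.
  by apply: seg_adds; [rewrite /= !inE; lia|rewrite /=; lia|segs].
by rewrite !big_cons big_nil h6 h9 h12; ring.
Qed.

Lemma TsegS k : Tseg k.+1 = Fseg k.+1 + (wt 8 * Tseg k + wt 10 * Fseg k
  + wt 11 * Useg k) * q ^+ (k * 8)%N.
Proof.
have h8 : hdgf (k * 8 + 8)%N = wt 8 * q ^+ (k * 8)%N * Tseg k.
  by apply: hdgfMD; [lia|lia|segs].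
have h10 : hdgf (k * 8 + 10)%N = wt 10 * q ^+ (k * 8)%N * Fseg k.
  by apply: hdgfMD; [lia|lia|segs].
have h11 : hdgf (k * 8 + 11)%N = wt 11 * q ^+ (k * 8)%N * Useg k.
  by apply: hdgfMD; [lia|lia|segs].
have -> : Tseg k.+1 = Fseg k.+1
    + \sum_(x <- [:: k * 8 + 8; k * 8 + 10; k * 8 + 11]%N) hdgf x.
  by apply: seg_adds; [rewrite /= !inE; lia|rewrite /=; lia|segs].
by rewrite !big_cons big_nil h8 h10 h11; ring.
Qed.

Lemma Fseg0 : Fseg 0 = 1.
Proof. by rewrite /Fseg /seg big_geq // addr0. Qed.

Lemma Tseg0 : Tseg 0 = 1 + wt 3.
Proof.
have h3 : hdgf 3 = wt 3 * q ^+ 0 * Fseg 0.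
  by apply: (@hdgfMD 0 3); [lia|lia|segs].
have -> : Tseg 0 = Fseg 0 + hdgf 3 by apply: seg_add; [lia|lia|lia|segs].
by rewrite h3 Fseg0; ring.
Qed.

Lemma Useg0 : Useg 0 = 1 + wt 3 + wt 1 + wt 4.
Proof.
have h1 : hdgf 1 = wt 1 * q ^+ 0 * Fseg 0.
  by apply: (@hdgfMD 0 1); [lia|lia|segs].
have h4 : hdgf 4 = wt 4 * q ^+ 0 * Fseg 0.
  by apply: (@hdgfMD 0 4); [lia|lia|segs].
have -> : Useg 0 = Tseg 0 + \sum_(x <- [:: 1; 4]%N) hdgf x.
  by apply: seg_adds; [|rewrite /=; lia|segs].
by rewrite !big_cons big_nil h1 h4 Tseg0 Fseg0; ring.
Qed.

(** The terms in T_k add up to a multiple of the T_k term of F_(k+1), so T and V can be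
    eliminated. *)
Lemma seg_coupled_rec :
  coupled_rec (b * q + a * q ^+ 3) (a * b * q ^+ 4) (q ^+ 4) Useg Fseg.
Proof.
have w1 : wt 1 = b * q by rewrite /wt mul1r.
have w3 : wt 3 = a * q ^+ 3 by rewrite /wt mulr1.
have w4 : wt 4 = a * b * q ^+ 4 by [].
have w5 : wt 5 = b * q ^+ 5 by rewrite /wt mul1r.
have w6 : wt 6 = b ^+ 2 * q ^+ 6 by rewrite /wt mul1r.
have w7 : wt 7 = a * q ^+ 7 by rewrite /wt mulr1.
have w8 : wt 8 = a * b * q ^+ 8 by [].
have w9 : wt 9 = b * q ^+ 9 by rewrite /wt mul1r.
have w10 : wt 10 = a ^+ 2 * q ^+ 10 by rewrite /wt mulr1.
have w11 : wt 11 = a * q ^+ 11 by rewrite /wt mulr1.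
have w12 : wt 12 = a * b * q ^+ 12 by [].
(* All powers of t are expressed through q^(8k), which is then generalized to a variable for
   [ring]. *)
have E k i : q ^+ 4 ^+ (k * 2 + i) = q ^+ (i * 4) * q ^+ (k * 8)%N.
  by rewrite -exprM -exprD; congr (q ^+ _); lia.
have E1 k : q ^+ 4 ^+ (k * 2).+1 = q ^+ 4 * q ^+ (k * 8)%N by have := E k 1%N; rewrite addn1.
have E2 k : q ^+ 4 ^+ (k * 2).+2 = q ^+ 8 * q ^+ (k * 8)%N by have := E k 2%N; rewrite addn2.
have E3 k : q ^+ 4 ^+ (k * 2).+3 = q ^+ 12 * q ^+ (k * 8)%N by have := E k 3%N; rewrite addn3.
have ES k : q ^+ (k.+1 * 8)%N = q ^+ 8 * q ^+ (k * 8)%N.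
  by rewrite -exprD; congr (q ^+ _); lia.
split.
- exact: Fseg0.
- by rewrite Useg0 w1 w3 w4; ring.
- by rewrite FsegS VsegE Useg0 Fseg0 Tseg0 w1 w3 w4 w5 w7; ring.
- move=> k; rewrite UsegS TsegS !FsegS !VsegE E1 E2 w5 w6 w7 w8 w9 w10 w11 w12.
  by move: (q ^+ (k * 8)%N) => z; ring.
- move=> k; rewrite (FsegS k.+1) VsegE TsegS ES !FsegS !VsegE E2 E3 w5 w7 w8 w10 w11.
  by move: (q ^+ (k * 8)%N) => z; ring.
Qed.
End Weights.

(** * Congruences modulo powers of q, and the product over odd parts *)

Definition cong (R : comNzRingType) (d x y : R) : Prop := exists z, x = y + d * z.

Section Cong.
Variable R : comNzRingType.
Implicit Types d x y z : R.

Lemma cong_refl d x : cong d x x.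
Proof. by exists 0; rewrite mulr0 addr0. Qed.

Lemma cong_sym d x y : cong d x y -> cong d y x.
Proof. by case=> z ->; exists (- z); ring. Qed.

Lemma cong_trans d x y z : cong d x y -> cong d y z -> cong d x z.
Proof. by move=> [u ->] [v ->]; exists (u + v); ring. Qed.

Lemma congMl d x y z : cong d x y -> cong d (z * x) (z * y).
Proof. by case=> u ->; exists (z * u); ring. Qed.

Lemma cong_exp_leq d i j x y : (i <= j)%N -> cong (d ^+ j) x y -> cong (d ^+ i) x y.
Proof.
by move=> ij [z ->]; exists (d ^+ (j - i) * z); rewrite mulrA -exprD subnKC.
Qed.

End Cong.

Section Product.
Variable R : comNzRingType.
Implicit Types a b q : R.

(** Up to terms carrying s or p, the recurrences read U_(k+1) = F_(k+1) and F_(k+2) = U_(k+1), with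
    initial values 1. *)
Lemma coupled_rec_cong1 (d x y t : R) U F k :
  coupled_rec (d * x) (d * y) t U F -> cong d (F k) 1.
Proof.
case=> F0 U0 F1 UE FE.
suff H j : cong d (U j) 1 /\ cong d (F j.+1) 1.
  by case: k => [|k]; [rewrite F0; exact: cong_refl | have [] := H k].
elim: j => [|j [[u Uj] [f Fj]]].
  by rewrite U0 F1; split; [exists (x + y)|exists (x + y + (x + y) * t)]; ring.
have [v Uj1] : cong d (U j.+1) 1.
  rewrite UE Fj; exists (f + (x + y * t ^+ (j * 2).+2) * (1 + d * f)
    - (1 - t ^+ (j * 2).+2) * (x * U j + y * t ^+ (j * 2).+1 * F j)).
  by move: (t ^+ _) (t ^+ _) => z z'; ring.
split; first by exists v.
exists (v + (x + y) * t ^+ (j * 2).+3 * F j.+1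
  - y * t ^+ (j * 2).+3 * (1 - t ^+ (j * 2).+2) * U j).
by rewrite FE Uj1; move: (t ^+ _) (t ^+ _) => z z'; ring.
Qed.

(** Beyond U_k, only 8k+5 and 8k+7 are allowed as largest parts in F_(k+1). *)
Lemma FsegS_cong a b q k : cong (q ^+ (k * 8)) (Fseg a b q k.+1) (Useg a b q k).
Proof.
rewrite FsegS VsegE; exists (wt a b q 7 * Fseg a b q k + wt a b q 5 * Tseg a b q k).
by ring.
Qed.

(** The factor 1 + s + p of the shift identity splits as (1 + b q)(1 + a q^3). *)
Lemma Useg_shift a b q k :
  Useg a b q k = (1 + b * q) * (1 + a * q ^+ 3) * Fseg (a * q ^+ 4) (b * q ^+ 4) q k.
Proof.
have rec' := seg_coupled_rec (a * q ^+ 4) (b * q ^+ 4) q.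
rewrite (coupled_rec_shift (U' := Useg (a * q ^+ 4) (b * q ^+ 4) q)
  (F' := Fseg (a * q ^+ 4) (b * q ^+ 4) q) k (seg_coupled_rec a b q)).
  by congr (_ * _); ring.
by congr coupled_rec : rec'; ring.
Qed.

Definition oddprod a b q m : R :=
  \prod_(i < m) ((1 + b * q ^+ (4 * i + 1)) * (1 + a * q ^+ (4 * i + 3))).

Lemma oddprodS a b q m : oddprod a b q m.+1 =
  (1 + b * q) * (1 + a * q ^+ 3) * oddprod (a * q ^+ 4) (b * q ^+ 4) q m.
Proof.
rewrite /oddprod big_ord_recl; congr (_ * _); apply: eq_bigr => i _.
have E c : q ^+ (4 * lift ord0 i + c)%N = q ^+ 4 * q ^+ (4 * i + c)%N.
  by rewrite lift0 mulnS -addnA exprD.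
by rewrite !E !mulrA.
Qed.

(** Each round passes from F_(k+1) to U_k and then to F'_k, splitting off two factors. The index
    never falls below j, so q^(8j) divides every error. *)
Lemma Fseg_oddprod a b q j m : cong (q ^+ (j * 8)) (Fseg a b q (j + m))
  (oddprod a b q m * Fseg (a * q ^+ (4 * m)) (b * q ^+ (4 * m)) q j).
Proof.
elim: m a b => [|m IH] a b.
  by rewrite addn0 muln0 expr0 !mulr1 /oddprod big_ord0 mul1r; exact: cong_refl.
rewrite addnS; apply: cong_trans (cong_exp_leq _ (FsegS_cong _ _ _ _)) _; first by lia.
rewrite Useg_shift oddprodS -[X in cong _ _ X]mulrA; apply: congMl.
have E c : c * q ^+ (4 * m.+1) = c * q ^+ 4 * q ^+ (4 * m).
  by rewrite -mulrA -exprD mulnS.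
by rewrite !E; exact: IH.
Qed.

Lemma Useg_oddprod a b q n :
  cong (q ^+ n.+1) (Useg a b q (n + n.+1)) (oddprod a b q n.+1).
Proof.
have le1 : (n.+1 <= (n + n.+1) * 8)%N by lia.
have le2 : (n.+1 <= n.+1 * 8)%N by lia.
apply: cong_trans (cong_sym (cong_exp_leq le1 (FsegS_cong a b q _))) _.
(* The successor of the index n + n.+1 splits as j + m with j = m = n.+1: j controls the errors, m
   the remaining F. *)
rewrite -addSn; apply: cong_trans (cong_exp_leq le2 (Fseg_oddprod a b q _ _)) _.
rewrite -[X in cong _ _ X]mulr1; apply: congMl.
apply: (cong_exp_leq (j := 4 * n.+1)); first by lia.
(* Both marks now carry d, so d divides s once and p twice. *)
set d := q ^+ _.
apply: (@coupled_rec_cong1 d (b * q + a * q ^+ 3) (a * b * d * q ^+ 4) (q ^+ 4)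
  (Useg (a * d) (b * d) q)).
by congr coupled_rec : (seg_coupled_rec (a * d) (b * d) q); ring.
Qed.

Lemma oddprodE a b q m :
  oddprod a b q m = \prod_(0 <= x < 4 * m | odd x) (1 + wt a b q x).
Proof.
elim: m => [|m IH]; first by rewrite /oddprod big_ord0 big_geq.
have w1 : wt a b q (4 * m).+1 = b * q ^+ (4 * m + 1).
  have u1 : ucol (4 * m).+1 = 0%N by rewrite /ucol; lia.
  have v1 : vcol (4 * m).+1 = 1%N by rewrite /vcol; lia.
  by rewrite /wt u1 v1 mul1r addn1.
have w3 : wt a b q (4 * m).+3 = a * q ^+ (4 * m + 3).
  have u3 : ucol (4 * m).+3 = 1%N by rewrite /ucol; lia.
  have v3 : vcol (4 * m).+3 = 0%N by rewrite /vcol; lia.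
  by rewrite /wt u3 v3 mulr1 addn3.
rewrite /oddprod big_ord_recr /= -/(oddprod a b q m) IH -w1 -w3.
rewrite [in RHS]big_mkcond (_ : 4 * m.+1 = (4 * m).+4)%N; last by lia.
by rewrite !big_nat_recr //= -big_mkcond /= !oddM /= !mulr1 mulrA.
Qed.

(** A factor 1 + [wt a b q x] with x >= n is 1 modulo q^n. *)
Lemma oddprod_cong a b q n m : (n <= 4 * m)%N ->
  cong (q ^+ n) (oddprod a b q m) (\prod_(0 <= x < n | odd x) (1 + wt a b q x)).
Proof.
rewrite oddprodE => /subnKC <-; elim: (_ - _)%N => [|d IH].
  by rewrite addn0; exact: cong_refl.
rewrite addnS big_mkcond big_nat_recr //= -big_mkcond /=.
apply: cong_trans IH; case: ifP => _; last by rewrite mulr1; exact: cong_refl.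
set P := \prod_(0 <= _ < _ | _) _.
exists (P * (a ^+ ucol (n + d) * b ^+ vcol (n + d) * q ^+ d)).
by rewrite /wt exprD; ring.
Qed.

Lemma oddprod_sets a b q n : \prod_(0 <= x < n | odd x) (1 + wt a b q x) =
  \sum_(A : {set 'I_n} | [forall i in A, odd i]) lwt a b q [seq val i | i <- enum A].
Proof.
rewrite big_mkord big_mkcond /=.
(* Even indices get weight 0, so the expansion over all subsets keeps only those with odd
   elements. *)
transitivity (\prod_(i < n) ((if odd i then wt a b q i else 0) + 1)).
  by apply: eq_bigr => i _; case: ifP; rewrite ?add0r // addrC.
rewrite bigA_distr [RHS]big_mkcond; apply: eq_bigr => A _ /=.
rewrite /lwt big_map big_enum /= -big_mkcond /=.
case: ifP => [/forall_inP odA|/negbT].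
  by apply: eq_bigr => i /odA ->.
by rewrite negb_forall_in => /exists_inP[i iA /negPf evi]; rewrite (bigD1 i) //= evi mul0r.
Qed.
End Product.

(** * Extraction of coefficients *)

Lemma count_set (n : nat) (A : {set 'I_n}) (p : pred nat) :
  count p [seq val i | i <- enum A] = #|[set i in A | p i]|.
Proof. by rewrite -sum1_count big_map big_enum_cond sum1dep_card. Qed.

(** On odd parts [D4_u] and [D4_v] reduce to the counts of parts 3 and 1 modulo 4, so both sides of
    the theorem are measured by the same statistics. *)
Lemma C4'_sets u v n : C4' u v n = (\sum_(A : {set 'I_n.+1} | [forall i in A, odd i])
  (let s := [seq val i | i <- enum A] in
   [&& D4_u s == u, D4_v s == v & sumn s == n]))%N.
Proof.
rewrite /C4' -sum1dep_card big_mkcond [RHS]big_mkcond; apply: eq_bigr => A _ /=.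
have -> : [forall i in A, (i %% 4 == 3) || (i %% 4 == 1)]%N = [forall i in A, odd i].
  by apply: eq_forallb => i; case: (i \in A) => //=; lia.
case: (boolP [forall i in A, odd i]) => odA; last by rewrite andbF.
have oddi (i : 'I_n.+1) : i \in A -> odd i by exact: (forall_inP odA).
have A0 : ord0 \notin A by apply/negP=> /oddi.
set s := map _ _.
have odds x : x \in s -> odd x.
  by case/mapP=> i; rewrite mem_enum => iA ->; exact: oddi.
have cnt p p' : (forall x, odd x -> p x = p' x) -> count p s = #|[set i in A | p' (val i)]|.
  by move=> pp'; rewrite -count_set; apply: eq_in_count => x /odds; exact: pp'.
have -> : D4_u s = #|[set i in A | (i : nat) %% 4 == 3]|%N.
  rewrite /D4_u (cnt _ (fun x => x %% 4 == 3)%N) ?(cnt _ pred0); try by move=> x /=; lia.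
  by rewrite -count_set count_pred0 muln0 addn0.
have -> : D4_v s = #|[set i in A | (i : nat) %% 4 == 1]|%N.
  rewrite /D4_v (cnt _ (fun x => x %% 4 == 1)%N) ?(cnt _ pred0); try by move=> x /=; lia.
  by rewrite -count_set count_pred0 muln0 addn0.
have -> : sumn s = (\sum_(i in A) i)%N by rewrite sumnE big_map big_enum.
rewrite /distinct_partition A0 /= andbT -andbA andbC -andbA.
by case: ifP.
Qed.

(** The outer variable is q, the middle one a and the innermost b. *)
Definition gf_coef (u v n : nat) (p : {poly {poly {poly int}}}) : int := p`_n`_u`_v.

Lemma gf_coef_lwt (s : seq nat) u v n :
  gf_coef u v n (lwt ('X%:P) ('X%:P%:P) 'X s)
    = [&& D4_u s == u, D4_v s == v & sumn s == n]%:R.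
Proof.
rewrite /gf_coef lwtE -!rmorphXn /= -polyCM coefCM coefXn [(n == _)%N]eq_sym.
case: eqP => _; last by rewrite mulr0 !coef0 !andbF.
rewrite mulr1 coefMC coefXn [(u == _)%N]eq_sym andbT.
case: eqP => _; last by rewrite mul0r coef0.
by rewrite mul1r coefXn eq_sym.
Qed.

Lemma gf_coef_sum (I : Type) (r : seq I) (P : pred I) F u v n :
  gf_coef u v n (\sum_(i <- r | P i) F i) = \sum_(i <- r | P i) gf_coef u v n (F i).
Proof. by rewrite /gf_coef !coef_sum. Qed.

Lemma gf_coef_cong u v n x y : cong ('X ^+ n.+1) x y -> gf_coef u v n x = gf_coef u v n y.
Proof. by case=> z ->; rewrite /gf_coef coefD coefXnM leqnn addr0. Qed.

Theorem theorem1p9 (u v n : nat) : C4' u v n = D4' u v n.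
Proof.
(* The bound is that of [Useg] at k = n + n.+1. *)
apply/eqP; rewrite -(eqr_nat int) (@D4'_declists u v n ((n + n.+1) * 8 + 5)); last by lia.
rewrite C4'_sets -sum1_count !natr_sum; apply/eqP.
pose q : {poly {poly {poly int}}} := 'X; pose a : {poly {poly {poly int}}} := 'X%:P.
pose b : {poly {poly {poly int}}} := 'X%:P%:P.
transitivity (gf_coef u v n (Useg a b q (n + n.+1))); last first.
  rewrite /Useg -gf_valid gf_coef_sum big_mkcond [RHS]big_mkcond; apply: eq_bigr => s _.
  have -> : hd_in predT s by case: s.
  by rewrite andbT gf_coef_lwt; case: (valid s) => //=; case: ifP.
rewrite (gf_coef_cong u v (Useg_oddprod a b q n)).
have le4 : (n.+1 <= 4 * n.+1)%N by lia.
rewrite (gf_coef_cong u v (oddprod_cong a b q le4)) oddprod_sets gf_coef_sum.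
by apply: eq_bigr => A _; rewrite gf_coef_lwt.
Qed.
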